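(* Let $A$ be a positive information algebra, let $L$ be a well-ordered set disjoint from $A$, let $S=A\uplus_{\mathrm{ord}}L$ be the overflow semiring, and let $J$ be a nonzero ideal of $S$. Type I: If $J$ contains a nonzero element of $A$, then $J=J_A\cup L$, where $J_A=J\cap A$ is an ideal of $A$. Moreover, $J$ is prime in $S$ if and only if $J_A$ is prime in $A$. Type II: If $J$ contains no nonzero element of $A$, then $J=\{0\}\cup\{\ell\in L:\ell\geq\ell_0\}$, where $\ell_0=\min(J\cap L)$, and $J$ is prime.
   Context: All semirings are commutative: $(S,+,0)$ and $(S,\cdot,1)$ are commutative monoids, $1\neq 0$, multiplication distributes over addition, and $0$ is absorbing. A semiring is zerosumfree if $a+b=0$ implies $a=b=0$, and entire if $ab=0$ implies $a=0$ or $b=0$; an information algebra is a zerosumfree entire semiring. A positive information algebra is an information algebra with a partial order $\leq$ compatible with $+$ and $\cdot$ (i.e. $x\leq y$ implies $x+z\leq y+z$ and $xz\leq yz$) and having $0$ as least element. An ideal of a semiring $S$ is a nonempty subset $I$ with $a+b\in I$ and $sa\in I$ for all $a,b\in I$, $s\in S$. A proper ideal $P$ ($P\neq S$) is prime if $ab\in P$ implies $a\in P$ or $b\in P$. Overflow semiring $S=A\uplus_{\mathrm{ord}}L$: for a positive information algebra $A$ and a join-semilattice $L$ disjoint from $A$, $S=A\cup L$ with the order extending those of $A$ and $L$ by $a\leq\ell$ for all $a\in A,\ell\in L$ (and never $\ell\leq a$), and operations: $x+y=x+_Ay$ if $x,y\in A$, $x+y=\sup\{x,y\}$ otherwise; $xy=x\cdot_Ay$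 if $x,y\in A\setminus\{0\}$, $xy=0$ if $x=0$ or $y=0$, and $xy=\sup\{x,y\}$ otherwise. With these, $S$ is a positive information algebra. *)

(* Defs.v *)
From HB Require Import structures.
From mathcomp Require Import all_boot all_order all_algebra.
From mathcomp Require Import boolp classical_sets wochoice.

Set Implicit Arguments.
Unset Strict Implicit.
Unset Printing Implicit Defensive.

Import Order.TTheory GRing.Theory.

Local Open Scope order_scope.
Local Open Scope ring_scope.
Local Open Scope classical_set_scope.

HB.mixin Record ComNzSemiRing_isInformationAlgebra R
    of GRing.ComNzSemiRing R := {
  zerosumfree : forall x y : R, x + y = 0 -> x = 0 /\ y = 0;
  entire : forall x y : R, x * y = 0 -> x = 0 \/ y = 0
}.

#[short(type="infoAlgType")]
HB.structure Definition InformationAlgebra :=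
  { R of ComNzSemiRing_isInformationAlgebra R & GRing.ComNzSemiRing R }.

(* The order is a field of the structure rather than an Order.POrder instance:
   Hierarchy Builder admits no join of Order.POrder with a structure that lacks
   additive inverses once Num.POrderedZmodule has been declared. *)
HB.mixin Record InformationAlgebra_isPositive R of InformationAlgebra R := {
  info_le : rel R;
  info_le_order : partial_order info_le;
  info_leD2r : forall x y z, info_le x y -> info_le (x + z) (y + z);
  info_leM2r : forall x y z, info_le x y -> info_le (x * z) (y * z);
  info_le0x : forall x, info_le 0 x
}.

#[short(type="posInfoAlgType")]
HB.structure Definition PositiveInformationAlgebra :=
  { R of InformationAlgebra_isPositive R & InformationAlgebra R }.

Lemma mulf_eq0_info (A : infoAlgType) (a b : A) :
  (a * b == 0) = (a == 0) || (b == 0).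
Proof.
apply/eqP/orP=> [/entire[]->|[]/eqP->]; rewrite ?eqxx ?mul0r ?mulr0 //.
- by left.
- by right.
Qed.

Lemma addr_eq0_info (A : infoAlgType) (a b : A) :
  (a + b == 0) = (a == 0) && (b == 0).
Proof.
apply/eqP/andP=> [/zerosumfree[-> ->]|[/eqP-> /eqP->]]; rewrite ?eqxx //.
by rewrite addr0.
Qed.

Section Ideals.
Variable S : comNzSemiRingType.
Implicit Types I P : set S.

Definition ideal I : Prop :=
  [/\ I !=set0,
      (forall a b, I a -> I b -> I (a + b)) &
      (forall s a, I a -> I (s * a))].

Definition prime_ideal P : Prop :=
  [/\ ideal P, P <> setT & (forall a b, P (a * b) -> P a \/ P b)].

End Ideals.

(* The carrier is a tagged sum, so that A and L are disjoint inside S. *)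
Definition overflow (A L : Type) : Type := (A + L)%type.
Definition ofA {A L : Type} (a : A) : overflow A L := inl a.
Definition ofL {A L : Type} (l : L) : overflow A L := inr l.

Section Overflow.
Variables (dL : Order.disp_t) (A : posInfoAlgType) (L : joinSemilatticeType dL).
Local Notation S := (overflow A L).
Implicit Types x y z : S.

Definition overflow_le x y : bool :=
  match x, y with
  | inl a, inl b => info_le a b
  | inl _, inr _ => true
  | inr _, inl _ => false
  | inr l, inr m => (l <= m)%O
  end.

(* As soon as one argument is in L, the sum and the product of nonzero elements
   are the supremum for overflow_le: see overflow_add_sup and overflow_mul_sup
   below. *)
Definition overflow_add x y : S :=
  match x, y with
  | inl a, inl b => inl (a + b)
  | inl _, inr m => inr m
  | inr l, inl _ => inr l
  | inr l, inr m => inr (l `|` m)%O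
  end.

Definition overflow_mul x y : S :=
  match x, y with
  | inl a, inl b => inl (a * b)
  | inl a, inr m => if a == 0 then inl 0 else inr m
  | inr l, inl b => if b == 0 then inl 0 else inr l
  | inr l, inr m => inr (l `|` m)%O
  end.

HB.instance Definition _ := Choice.copy S (A + L)%type.

Fact overflow_le_order : partial_order overflow_le.
Proof.
have [[leAxx leA_trans] leA_anti] := @info_le_order A.
split; first split.
- by case=> a /=.
- by move=> [b|m] [a|l] [c|n] //=; [apply: leA_trans | apply: le_trans].
- by move=> [a|l] [b|m] //= => [/leA_anti->|/le_anti->].
Qed.

Fact overflow_addA : associative overflow_add.
Proof. by move=> [a|l] [b|m] [c|n] //=; rewrite ?addrA ?joinA. Qed.

Fact overflow_addC : commutative overflow_add.
Proof. by move=> [a|l] [b|m] //=; rewrite 1?addrC 1?joinC. Qed.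

Fact overflow_add0 : left_id (inl 0) overflow_add.
Proof. by move=> [a|l] //=; rewrite add0r. Qed.

Fact overflow_mulA : associative overflow_mul.
Proof.
move=> [a|l] [b|m] [c|n] //=; rewrite ?mulrA ?joinA ?mulf_eq0_info //.
- by case: (eqVneq b 0) => _ /=; rewrite ?mulr0 ?orbT ?orbF.
- case: (eqVneq c 0) => [->|/negPf c0]; case: (eqVneq a 0) => _ /=;
  by rewrite ?mulr0 ?mul0r ?eqxx ?c0.
- by case: (eqVneq a 0) => _ /=; rewrite ?eqxx.
- by case: (eqVneq b 0) => _ //=; rewrite mul0r.
- by case: (eqVneq b 0) => _ /=; rewrite ?eqxx.
- by case: (eqVneq c 0) => _ /=; rewrite ?eqxx.
Qed.

Fact overflow_mulC : commutative overflow_mul.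
Proof. by move=> [a|l] [b|m] //=; rewrite 1?mulrC 1?joinC. Qed.

Fact overflow_mul1 : left_id (inl 1) overflow_mul.
Proof. by move=> [a|l] //=; rewrite ?mul1r ?oner_eq0. Qed.

Fact overflow_mulDl : left_distributive overflow_mul overflow_add.
Proof.
move=> [a|l] [b|m] [c|n] //=; rewrite ?mulrDl ?addr_eq0_info ?joinxx //.
- by case: (eqVneq a 0) => _; case: (eqVneq b 0) => _ //=;
  rewrite ?addr0 ?joinxx.
- by case: (eqVneq c 0) => [->|_] //=; rewrite mulr0 addr0.
- by case: (eqVneq a 0) => _ //=; rewrite (joinC m n) joinA joinxx.
- by case: (eqVneq c 0) => [->|_] //=; rewrite mulr0 addr0.
- by case: (eqVneq b 0) => _ //=; rewrite -joinA joinxx.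
- by case: (eqVneq c 0) => _ //=; rewrite addr0.
- by rewrite joinACA joinxx.
Qed.

Fact overflow_mul0 : left_zero (inl 0) overflow_mul.
Proof. by move=> [a|l] //=; rewrite ?mul0r ?eqxx. Qed.
Fact overflow_1neq0 : inl 1 != inl 0 :> S.
Proof. by apply/eqP => -[/eqP]; rewrite oner_eq0. Qed.

HB.instance Definition _ :=
  GRing.isNmodule.Build S overflow_addA overflow_addC overflow_add0.

HB.instance Definition _ := GRing.Nmodule_isComNzSemiRing.Build S
  overflow_mulA overflow_mulC overflow_mul1 overflow_mulDl overflow_mul0
  overflow_1neq0.

Fact overflow_zerosumfree x y : x + y = 0 -> x = 0 /\ y = 0.
Proof. by case: x y => [a|l] [b|m] //= [/zerosumfree[-> ->]]. Qed.

Fact overflow_entire x y : x * y = 0 -> x = 0 \/ y = 0.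
Proof.
have mulE : x * y = overflow_mul x y by [].
rewrite {}mulE; case: x y => [a|l] [b|m] //=.
- by case=> /entire[->|->]; [left | right].
- by case: eqP => // -> _; left.
- by case: eqP => // -> _; right.
Qed.

HB.instance Definition _ := ComNzSemiRing_isInformationAlgebra.Build S
  overflow_zerosumfree overflow_entire.

Fact overflow_leD2r x y z :
  overflow_le x y -> overflow_le (x + z) (y + z).
Proof.
change (overflow_le x y ->
  overflow_le (overflow_add x z) (overflow_add y z)).
case: x y z => [a|l] [b|m] [c|n] //=.
- exact: info_leD2r.
- by move=> _; rewrite leUr.
- by move=> lem; rewrite leU2.
Qed.

Fact overflow_leM2r x y z :
  overflow_le x y -> overflow_le (x * z) (y * z).
Proof.
change (overflow_le x y ->
  overflow_le (overflow_mul x z) (overflow_mul y z)).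
have [_ leA_anti] := @info_le_order A.
case: x y z => [a|l] [b|m] [c|n] //=.
- exact: info_leM2r.
- case: (eqVneq b 0) => [->|_] le_ab; last by case: ifP => /=.
  have -> : a = 0 by apply: leA_anti; rewrite le_ab info_le0x.
  by rewrite eqxx /= info_le0x.
- by case: (eqVneq c 0) => [->|] //= _; rewrite mulr0 info_le0x.
- by case: (eqVneq a 0) => _ //= _; rewrite ?info_le0x ?leUr.
- by case: (eqVneq c 0) => _ //= _; rewrite info_le0x.
- by move=> lem; rewrite leU2.
Qed.

Fact overflow_le0x x : overflow_le 0 x.
Proof. by case: x => [a|l] //=; exact: info_le0x. Qed.

HB.instance Definition _ := InformationAlgebra_isPositive.Build S
  overflow_le_order overflow_leD2r overflow_leM2r overflow_le0x.

Lemma overflow_add_sup x (l : L) :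
  [/\ info_le x (x + ofL l), info_le (ofL l) (x + ofL l) &
      forall u : S, info_le x u -> info_le (ofL l) u ->
        info_le (x + ofL l) u].
Proof.
change ([/\ overflow_le x (overflow_add x (ofL l)),
  overflow_le (ofL l) (overflow_add x (ofL l)) &
  forall u : S, overflow_le x u -> overflow_le (ofL l) u ->
    overflow_le (overflow_add x (ofL l)) u]).
case: x => [a|k]; split=> //=; rewrite ?leUl ?leUr //.
by case=> //= m; rewrite leUx => -> ->.
Qed.

Lemma overflow_mul_sup x (l : L) : x != 0 -> x * ofL l = x + ofL l.
Proof.
case: x => [a|k] // a0; change (overflow_mul (inl a) (inr l) = inr l) => /=.
by case: eqP => // a_eq0; rewrite a_eq0 eqxx in a0.
Qed.

End Overflow.

(* Main.v *)
(* A nonzero element of A acts as the identity on L, and a product of two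
   elements of L is their join.  Hence an ideal containing a nonzero element of
   A swallows all of L, so that its primality is decided inside A, whereas an
   ideal meeting A only in 0 is {0} together with an up-set of L, which is
   principal when L is well-ordered and prime because L is a chain. *)
Require Import Defs.
From mathcomp Require Import all_boot all_order all_algebra.
From mathcomp Require Import boolp classical_sets wochoice.

Set Implicit Arguments.
Unset Strict Implicit.
Unset Printing Implicit Defensive.

Import Order.TTheory GRing.Theory.

Local Open Scope ring_scope.
Local Open Scope classical_set_scope.

Lemma ideal0 (R : comNzSemiRingType) (I : set R) : ideal I -> I 0.
Proof. by move=> [[x Ix] _ idM]; rewrite -(mul0r x); exact: idM. Qed.

Section OverflowIdeals.
Variables (A : posInfoAlgType) (dL : Order.disp_t) (L : joinSemilatticeType dL).
Local Notation S := (overflow A L).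
Implicit Types (a b : A) (l m : L) (J : set S).

Lemma ofAD a b : ofA (a + b) = ofA a + ofA b :> S. Proof. by []. Qed.

Lemma ofAM a b : ofA (a * b) = ofA a * ofA b :> S. Proof. by []. Qed.

Lemma ofLM l m : ofL l * ofL m = ofL (Order.join l m) :> S.
Proof. by []. Qed.

Lemma ofA_mul_ofL a l : a != 0 -> ofA a * ofL l = ofL l :> S.
Proof. by move=> a0; exact: overflow_mul_sup. Qed.

Lemma ideal_contract J : ideal J -> ideal ((@ofA A L) @^-1` J).
Proof.
move=> J_ideal; have [_ idD idM] := J_ideal; split.
- by exists 0; exact: (ideal0 J_ideal).
- by move=> a b Ja Jb /=; rewrite ofAD; exact: idD.
- by move=> a b Jb /=; rewrite ofAM; exact: idM.
Qed.

Lemma ideal_ofL J a l : ideal J -> a != 0 -> J (ofA a) -> J (ofL l).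
Proof.
by move=> [_ _ idM] a0 Ja; rewrite -(ofA_mul_ofL l a0) mulrC; exact: idM.
Qed.

(** The join of [m] and [l] is [m], so [ofL m] equals [ofL m * ofL l], a multiple of an element of
    [J]. *)
Lemma ideal_ofL_le J l m : ideal J -> (l <= m)%O -> J (ofL l) -> J (ofL m).
Proof.
by move=> [_ _ idM] lem Jl; rewrite -(join_l lem) -ofLM; exact: idM.
Qed.

(** Once [J] contains [L], every element outside [J] comes from [A], so properness and the prime
    condition need testing only there. *)
Lemma prime_ideal_contract J : ideal J -> (forall l, J (ofL l)) ->
  prime_ideal J <-> prime_ideal ((@ofA A L) @^-1` J).
Proof.
move=> J_ideal JL; split=> [[_ J_proper J_prime]|[_ JA_proper JA_prime]].
  split; [exact: ideal_contract| |by move=> a b /=; rewrite ofAM => /J_prime].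
  move=> JAT; apply: J_proper; apply/seteqP; split=> // -[a|l] _; last exact: JL.
  by have : [set: A] a by []; rewrite -JAT.
split=> //; first by move=> JT; apply: JA_proper; rewrite JT.
move=> [a|l] [b|m]; [exact: JA_prime|right|left|left]; exact: JL.
Qed.

End OverflowIdeals.

(** Products within [A] are settled by [entire]; products within [L] by totality, the join being one
    of the two factors. *)
Lemma prime_ideal_no_ofA (A : posInfoAlgType) dL (L : orderType dL)
    (J : set (overflow A L)) :
  ideal J -> (forall a, J (ofA a) -> a = 0) -> prime_ideal J.
Proof.
move=> J_ideal JA0; split=> // [JT|].
  (* [J] is proper because it misses the unit, a nonzero element of [A]. *)
  by case/eqP: (oner_neq0 A); apply: JA0; rewrite JT.
(* A mixed product either has the factor 0, which lies in [J], or equals its factor from [L]. *)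
have ofAL a l : J (ofA a * ofL l) -> J (ofA a) \/ J (ofL l).
  have [->|a0] := eqVneq a 0; first by left; exact: (ideal0 J_ideal).
  by rewrite ofA_mul_ofL //; right.
move=> [a|l] [b|m].
- move=> /JA0/entire[] ->; [left|right]; exact: (ideal0 J_ideal).
- exact: ofAL.
- by rewrite mulrC => /ofAL[]; [right|left].
- rewrite (ofLM A l m); case: (leP l m) => _; [by right|by left].
Qed.

Theorem theorem4p3 (A : posInfoAlgType) (dL : Order.disp_t) (L : orderType dL)
    (L_wo : wochoice.well_order (<=%O : rel L))
    (J : set (overflow A L)) (J_ideal : ideal J) (J_neq0 : J <> [set 0]) :
  let J_A : set A := ofA @^-1` J in
  let J_L : set L := ofL @^-1` J in
  ((exists2 a : A, a != 0 & J (ofA a)) ->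
     [/\ J = ofA @` J_A `|` range ofL,
         ideal J_A &
         prime_ideal J <-> prime_ideal J_A]) /\
  (~ (exists2 a : A, a != 0 & J (ofA a)) ->
     exists l0 : L,
       [/\ J_L l0 /\ lbound J_L l0,
           J = [set 0] `|` ofL @` [set l | (l0 <= l)%O] &
           prime_ideal J]).
Proof.
move=> J_A J_L; split=> [[a a0 Ja]|JA_none].
  have JL l : J (ofL l) by exact: (ideal_ofL l J_ideal a0 Ja).
  split; [|exact: ideal_contract|exact: prime_ideal_contract].
  apply/seteqP; split=> [[b|l] Jx|_ [[b Jb <-]|[l _ <-]] //].
  - by left; exists b.
  - by right; exists l.
have JA0 a : J (ofA a) -> a = 0.
  by move=> Ja; apply/eqP/negPn/negP => a0; apply: JA_none; exists a.
have J0 := ideal0 J_ideal.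
(* Otherwise [J] would be reduced to 0. *)
have [l Jl] : exists l, J_L l.
  apply: contrapT => JL_none; apply: J_neq0; apply/seteqP.
  split=> [[a|l] Jx|_ -> //]; first by rewrite (JA0 _ Jx).
  by case: JL_none; exists l.
(* The well-order is applied to the boolean form of [J_L]; the uniqueness of the minimum is
   dropped. *)
have [|l0 [[/asboolP Jl0 l0_min] _]] := L_wo (fun l => `[< J_L l >]).
  by exists l; apply/asboolP.
exists l0; split; last exact: prime_ideal_no_ofA.
- by split=> // m Jm; apply: l0_min; apply/asboolP.
(* Minimality of [l0] gives one inclusion, upward closure of [J] in [L] the other. *)
- apply/seteqP; split=> [[a|m] Jx|_ [->|[m /= l0m <-]]] //.
  + by left; rewrite (JA0 _ Jx).
  + by right; exists m => //=; apply: l0_min; apply/asboolP.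
  + exact: (ideal_ofL_le J_ideal l0m Jl0).
Qed.
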